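(* Let $\mathcal H$ be an infinite dimensional separable complex Hilbert space and let $\mathrm U(\mathcal H)$ be the group of all unitary operators $\mathcal H\to\mathcal H$. Then $\mathrm U(\mathcal H)$, equipped with the strong topology, is a contractible topological space.
   Context: The strong topology on $\mathrm U(\mathcal H)$ is the strong operator topology, i.e. the topology of pointwise convergence on $\mathcal H$ in norm, induced by the seminorms $T\mapsto\|Tf\|$, $f\in\mathcal H$. *)

(* Defs.v *)
From HB Require Import structures.
From mathcomp Require Import all_boot all_order all_algebra sesquilinear.
From mathcomp Require Import complex.
From mathcomp Require Import all_classical all_reals.
From mathcomp Require Import topology normedtype.

Set Implicit Arguments.
Unset Strict Implicit.
Unset Printing Implicit Defensive.

Import Order.TTheory GRing.Theory Num.Theory Num.Def.
Import numFieldNormedType.Exports.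

Local Open Scope classical_set_scope.
Local Open Scope ring_scope.
Local Open Scope complex_scope.

Definition homotopic (R : realType) (X Y : topologicalType) (f g : X -> Y) :=
  exists F : R * X -> Y,
    [/\ {within `[0, 1] `*` [set: X], continuous F},
        forall x, F (0, x) = f x
      & forall x, F (1, x) = g x].

Definition contractible (R : realType) (X : topologicalType) :=
  exists x0 : X, homotopic R (@idfun X) (cst x0).

Definition separable_space (X : topologicalType) :=
  exists2 D : set X, countable D & dense D.

Definition finite_dimensional (K : fieldType) (V : lmodType K) :=
  exists s : seq V, forall v : V,
    exists c : 'I_(size s) -> K, v = \sum_i c i *: s`_i.

Definition infinite_dimensional (K : fieldType) (V : lmodType K) :=
  ~ finite_dimensional V.

(* A complex Hilbert space is given by a complete normed space H over R[i]
   together with a scalar product (linear in its first argument) that induces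
   the norm of H. *)
Definition induces_norm (R : realType) (H : normedModType R[i])
    (dot : {dot H for conjC}) :=
  forall x : H, `|x| ^+ 2 = dot x x.

Definition unitary (R : realType) (H : normedModType R[i])
    (dot : {dot H for conjC}) (T : H -> H) :=
  [/\ linear T, bijective T & isometry dot dot T].

(* As a subtype of {ptws H -> H}, U(H) inherits the topology of pointwise
   convergence in norm, i.e., the strong operator topology. *)
Definition unitary_group (R : realType) (H : normedModType R[i])
    (dot : {dot H for conjC}) : Type :=
  set_type [set T : {ptws H -> H} | unitary dot T].

HB.instance Definition _ (R : realType) (H : normedModType R[i])
    (dot : {dot H for conjC}) :=
  Topological.copy (unitary_group dot)
    (set_type [set T : {ptws H -> H} | unitary dot T]).

Section unitary_group_group.
Context (R : realType) (H : normedModType R[i]) (dot : {dot H for conjC}).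
Implicit Types T U : unitary_group dot.

Lemma unitary_id : unitary dot idfun.
Proof. by split=> //; exists idfun. Qed.

Lemma unitary_comp (f g : H -> H) :
  unitary dot f -> unitary dot g -> unitary dot (f \o g).
Proof.
move=> [lf bf df] [lg bg dg]; split.
- by move=> a x y /=; rewrite lg lf.
- exact: bij_comp.
- by move=> x y /=; rewrite df dg.
Qed.

Lemma unitary_inv (f g : H -> H) :
  cancel f g -> cancel g f -> unitary dot f -> unitary dot g.
Proof.
move=> fg gf [lf bf df]; split.
- by move=> a x y; apply: (can_inj fg); rewrite lf !gf.
- by exists f.
- by move=> x y; rewrite -df !gf.
Qed.

Lemma unitary_groupP T : unitary dot (set_val T).
Proof. exact: set_valP T. Qed.

Definition to_unitary (f : H -> H) (uf : unitary dot f) : unitary_group dot :=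
  exist _ (f : {ptws H -> H}) (mem_set uf).

Lemma unitary_group_inj T U : set_val T =1 set_val U -> T = U.
Proof. by move=> /funext TU; apply: val_inj. Qed.

Lemma unitary_inverse T :
  exists U, cancel (set_val T) (set_val U) /\ cancel (set_val U) (set_val T).
Proof.
have uT := unitary_groupP T; have [_ [g fg gf] _] := uT.
by exists (to_unitary (unitary_inv fg gf uT)).
Qed.

Definition unitary_mul T U :=
  to_unitary (unitary_comp (unitary_groupP T) (unitary_groupP U)).

Definition unitary_invg T := projT1 (cid (unitary_inverse T)).

Lemma unitary_mulA : associative unitary_mul.
Proof. by move=> T U V; apply: unitary_group_inj. Qed.

Lemma unitary_mul1g : left_id (to_unitary unitary_id) unitary_mul.
Proof. by move=> T; apply: unitary_group_inj. Qed.

Lemma unitary_mulg1 : right_id (to_unitary unitary_id) unitary_mul.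
Proof. by move=> T; apply: unitary_group_inj. Qed.

Lemma unitary_mulVg :
  left_inverse (to_unitary unitary_id) unitary_invg unitary_mul.
Proof.
move=> T; apply: unitary_group_inj => x.
by rewrite /unitary_invg; case: cid => U [TU _] /=; exact: TU.
Qed.

Lemma unitary_mulgV :
  right_inverse (to_unitary unitary_id) unitary_invg unitary_mul.
Proof.
move=> T; apply: unitary_group_inj => x.
by rewrite /unitary_invg; case: cid => U [_ UT] /=; exact: UT.
Qed.

HB.instance Definition _ := isGroup.Build (unitary_group dot)
  unitary_mulA unitary_mul1g unitary_mulg1 unitary_mulVg unitary_mulgV.

End unitary_group_group.

Lemma strong_cvgP (R : realType) (H : normedModType R[i])
    (dot : {dot H for conjC}) (F : set_system (unitary_group dot))
    (T : unitary_group dot) : Filter F ->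
  F --> T <->
  forall x, (fun U : unitary_group dot => set_val U x) @ F --> set_val T x.
Proof.
move=> FF.
pose v : unitary_group dot -> {ptws H -> H} := set_val.
have -> : F --> T <-> v @ F --> v T.
  split=> [FT|FT A [_ [[B oB <-] BT] BA]].
    apply: cvg_trans (cvg_app v FT) _.
    exact: (@initial_continuous _ _ v T).
  by apply: filterS BA _; apply: FT; exact: open_nbhs_nbhs.
exact: pointwise_cvgP.
Qed.

Lemma strong_normP (R : realType) (H : normedModType R[i])
    (dot : {dot H for conjC}) (F : set_system (unitary_group dot))
    (T : unitary_group dot) : Filter F ->
  F --> T <-> forall x (e : R[i]), 0 < e ->
    \forall U \near F, `|set_val T x - set_val U x| < e.
Proof.
move=> FF; rewrite strong_cvgP.
by split=> h x; apply/cvgrPdist_lt; exact: h.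
Qed.

(* Main.v *)
(** Let [V u], for [u >= 0], be a path of isometries with [V 0 = 1].  Then
    [V U V^* + 1 - V V^*] is unitary, and it contracts [U] to the identity as
    soon as the adjoints [V u^*] are strongly continuous in [u] and tend
    strongly to [0] at infinity.  No continuity of [V u] itself is needed,
    because on unitary operators the weak and the strong topology coincide.

    Such a path is obtained by moving the vectors of an orthonormal basis [e]
    one at a time: between the times [j] and [j + 1], the vector that started
    at [e k] is rotated from [e (k + j)] to [e (k + j + 1)] in the plane they
    span, the larger indices [k] moving first, so that the target is already
    free.  At time [j] the isometry is the [j]-th power of the shift. *)

Require Import Defs.
From HB Require Import structures.
From mathcomp Require Import all_boot all_order all_algebra.
From mathcomp Require Import complex.
From mathcomp Require Import all_classical all_reals.
From mathcomp Require Import topology normedtype sequences realfun.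
From mathcomp Require Import ring lra zify.
Import Order.TTheory GRing.Theory Num.Theory Num.Def.
Import numFieldNormedType.Exports.
Local Open Scope classical_set_scope.
Local Open Scope ring_scope.
Local Open Scope complex_scope.

Set Implicit Arguments.
Unset Strict Implicit.
Unset Printing Implicit Defensive.

Section dot_product.
Context (C : numClosedFieldType) (V : lmodType C) (dot : {dot V for conjC}).
Implicit Types (a : C) (x y z : V) (f g : V -> V) (s : seq V).

Lemma dotC x y : dot x y = conjC (dot y x).
Proof. by rewrite hermC expr0 mul1r. Qed.

Lemma dotZl a x y : dot (a *: x) y = a * dot x y.
Proof. by rewrite linearZl. Qed.

Lemma dotZr a x y : dot x (a *: y) = conjC a * dot x y.
Proof. by rewrite linearZr. Qed.

Lemma dot_CauchySchwarz x y : `|dot x y| ^+ 2 <= dot x x * dot y y.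
Proof.
have [->|y_neq0] := eqVneq y 0; first by rewrite !linear0r normr0 expr0n mulr0.
have yy_gt0 : 0 < dot y y by rewrite dnorm_gt0.
rewrite -subr_ge0 -(pmulr_rge0 _ yy_gt0).
have := dnorm_ge0 dot (dot y y *: x - dot x y *: y).
rewrite dnormB !dnormZ dotZl dotZr [`|dot y y|]gtr0_norm//= normCK => h.
have yyC : conjC (dot y y) = dot y y by rewrite -dotC.
by congr (0 <= _) : h; rewrite !rmorphM/= yyC conjCK; ring.
Qed.

Lemma dot_inj x y : dot x =1 dot y -> x = y.
Proof.
by move=> xy; apply/eqP; rewrite -subr_eq0 -(dnorm_eq0 dot) linearBl/= xy subrr.
Qed.

Definition adjoint f g := forall x y, dot (f x) y = dot x (g y).

Lemma adjointC f g : adjoint f g -> adjoint g f.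
Proof. by move=> fg x y; rewrite dotC -fg -dotC. Qed.

Lemma adjoint_linear f g : adjoint f g -> linear f.
Proof.
by move=> fg a x y; apply: dot_inj => z; rewrite fg !linearPl/= -!fg.
Qed.

Section orthonormal_family.
Context (I : eqType).
Implicit Types (v w : I -> V) (r : seq I) (c : I -> C).

Definition orthonormal_family v := forall i j, dot (v i) (v j) = (i == j)%:R.

Definition dyad_sum v w r x := \sum_(i <- r) dot x (v i) *: w i.

Lemma dyad_sum_adjoint v w r : adjoint (dyad_sum v w r) (dyad_sum w v r).
Proof.
move=> x y; rewrite linear_sumlz linear_sumr/=; apply: eq_bigr => i _.
by rewrite dotZl dotZr -dotC mulrC.
Qed.

Lemma dot_sum_orthonormal v r c j : uniq r ->
    {in r, forall i, dot (v i) (v j) = (i == j)%:R} ->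
  dot (\sum_(i <- r) c i *: v i) (v j) = if j \in r then c j else 0.
Proof.
move=> r_uniq vj; rewrite linear_sumlz/=; case: ifPn => [jr|/memPn rj].
  rewrite (bigD1_seq j)//= dotZl vj// eqxx mulr1 big1_seq ?addr0//.
  by move=> i /andP[/negPf ij ir]; rewrite dotZl vj// ij mulr0.
by rewrite big1_seq// => i ir; rewrite dotZl vj// (negPf (rj _ ir)) mulr0.
Qed.

Lemma dnorm_sum_orthonormal v r c : orthonormal_family v -> uniq r ->
  dot (\sum_(i <- r) c i *: v i) (\sum_(i <- r) c i *: v i) =
  \sum_(i <- r) `|c i| ^+ 2.
Proof.
move=> v_on r_uniq; rewrite [LHS]linear_sumr/=; apply: eq_big_seq => i ir.
by rewrite dotZr dot_sum_orthonormal// ?ir ?normCKC// => j _; exact: v_on.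
Qed.

Lemma dnorm_residue v r x : orthonormal_family v -> uniq r ->
  dot (x - dyad_sum v v r x) (x - dyad_sum v v r x) =
  dot x x - \sum_(i <- r) `|dot x (v i)| ^+ 2.
Proof.
move=> v_on r_uniq; rewrite dnormB dnorm_sum_orthonormal//.
have -> : dot x (dyad_sum v v r x) = \sum_(i <- r) `|dot x (v i)| ^+ 2.
  by rewrite linear_sumr/=; apply: eq_bigr => i _; rewrite dotZr normCKC.
rewrite [conjC _]geC0_conj ?sumr_ge0// => [|i _]; last by rewrite exprn_ge0.
by rewrite opprD addrA addrK.
Qed.

Lemma bessel v r x : orthonormal_family v -> uniq r ->
  \sum_(i <- r) `|dot x (v i)| ^+ 2 <= dot x x.
Proof. by move=> *; rewrite -subr_ge0 -dnorm_residue. Qed.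

End orthonormal_family.

Lemma dyad_sum_fixed_leq (e : nat -> V) m n x :
    orthonormal_family e -> (m <= n)%N ->
  dyad_sum e e (index_iota 0 m) x = x -> dyad_sum e e (index_iota 0 n) x = x.
Proof.
move=> e_on mn mx; have := dnorm_residue x e_on (iota_uniq 0 (m - 0)).
rewrite mx subrr linear0l => /esym/subr0_eq xx.
apply/esym/subr0_eq/eqP; rewrite -(dnorm_eq0 dot) eq_le dnorm_ge0 andbT.
rewrite dnorm_residue ?iota_uniq// xx -[X in \sum_(i <- X) _]/(index_iota 0 m).
rewrite (big_cat_nat (leq0n m) mn)/= opprD addrA subrr sub0r oppr_le0.
by rewrite sumr_ge0// => i _; rewrite exprn_ge0.
Qed.

Lemma orthonormal_rcons s y : orthonormal dot s -> dot y y = 1 ->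
  {in s, forall z, dot y z = 0} -> orthonormal dot (rcons s y).
Proof.
move=> s_on yy ys; rewrite -cats1 orthonormal_cat s_on /orthonormal/= yy eqxx/=.
by apply/allP => z zs/=; rewrite dotC ys// rmorph0 eqxx.
Qed.

Lemma orthonormal_family_mkseq (v : nat -> V) :
  (forall n, orthonormal dot (mkseq v n)) -> orthonormal_family v.
Proof.
move=> v_on i j; have /orthonormalP[v_uniq dotv] := v_on (maxn i j).+1.
have vi k : (k <= maxn i j)%N -> v k = (mkseq v (maxn i j).+1)`_k.
  by move=> kij; rewrite nth_mkseq.
rewrite (vi i) ?leq_maxl// (vi j) ?leq_maxr//.
rewrite dotv ?mem_nth ?size_mkseq ?ltnS ?leq_maxl ?leq_maxr//.
by rewrite nth_uniq ?size_mkseq ?ltnS ?leq_maxl ?leq_maxr.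
Qed.

Lemma infinite_dimensional_residue_neq0 s : infinite_dimensional V ->
  exists x, x - dyad_sum id id s x != 0.
Proof.
apply: contra_notP => no_residue; exists s => x; exists (fun i => dot x s`_i).
have : x - dyad_sum id id s x = 0.
  by apply/eqP/negPn/negP => x_res; apply: no_residue; exists x.
by move/subr0_eq => {1}->; rewrite /dyad_sum (big_nth 0) big_mkord.
Qed.

Lemma orthonormal_extend s x : infinite_dimensional V -> orthonormal dot s ->
  exists y, orthonormal dot (rcons s y) /\ dyad_sum id id (rcons s y) x = x.
Proof.
move=> dimV s_on; pose residue z := z - dyad_sum id id s z.
have residue_orth z y : y \in s -> dot (residue z) y = 0.
  have /orthonormalP[s_uniq dots] := s_on; move=> ys.
  rewrite linearBl/= (dot_sum_orthonormal (v := id) (dot z))// ?ys ?subrr//.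
  by move=> u us; exact: dots.
have [z z_neq0 [a xz]] : exists2 z, residue z != 0 &
    exists a, residue x = a *: residue z.
  have [rx0|rx_neq0] := eqVneq (residue x) 0; last first.
    by exists x => //; exists 1; rewrite scale1r.
  have [z z_neq0] := infinite_dimensional_residue_neq0 s dimV.
  by exists z => //; exists 0; rewrite rx0 scale0r.
pose n := sqrtC (dot (residue z) (residue z)); pose y := n^-1 *: residue z.
have n_neq0 : n != 0 by rewrite sqrt_dnorm_eq0.
have yy1 : dot y y = 1.
  rewrite dnormZ -[dot (residue z) _]sqrtCK -/n.
  rewrite ger0_norm ?invr_ge0 ?sqrt_dnorm_ge0//.
  by rewrite -exprMn mulVf ?expr1n.
have ys u : u \in s -> dot y u = 0.
  by move=> us; rewrite dotZl residue_orth ?mulr0.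
exists y; split; first exact: orthonormal_rcons.
have dot_xy : dot x y = dot (residue x) y.
  rewrite linearBl/= dyad_sum_adjoint [dyad_sum _ _ _ y]big1_seq.
    by rewrite linear0r subr0.
  by move=> u us; rewrite ys ?scale0r.
have xy : residue x = (a * n) *: y by rewrite scalerA mulfK.
by rewrite /dyad_sum big_rcons/= dot_xy xy dotZl yy1 mulr1 -xy addrC subrK.
Qed.

Lemma gram_schmidt (d : nat -> V) : infinite_dimensional V ->
  exists e, orthonormal_family e /\
    forall n, dyad_sum e e (index_iota 0 n.+1) (d n) = d n.
Proof.
move=> dimV.
have /choice[g gP] (p : seq V * V) : exists y, orthonormal dot p.1 ->
    orthonormal dot (rcons p.1 y) /\ dyad_sum id id (rcons p.1 y) p.2 = p.2.
  have [p_on|] := boolP (orthonormal dot p.1); last by exists 0.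
  by have [y] := orthonormal_extend p.2 dimV p_on; exists y.
pose s := fix s n := if n is m.+1 then rcons (s m) (g (s m, d m)) else [::].
pose e n := g (s n, d n).
have sE n : s n = mkseq e n by elim: n => //= n IH; rewrite mkseqS -IH.
have s_on n : orthonormal dot (s n).
  by elim: n => // n IH; exact: (gP (s n, d n) IH).1.
exists e; split; first by apply: orthonormal_family_mkseq => n; rewrite -sE.
move=> n; have [_] := gP (s n, d n) (s_on n).
by rewrite -[rcons _ _]/(s n.+1) sE /dyad_sum big_map /index_iota subn0.
Qed.

End dot_product.

Section nonexpansive.
Context (K : numFieldType) (U W : normedModType K).

Definition nonexpansive (f : U -> W) := forall x y, `|f x - f y| <= `|x - y|.

Lemma linear_nonexpansive (f : U -> W) :
  linear f -> (forall x, `|f x| <= `|x|) -> nonexpansive f.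
Proof. by move=> flin fle x y; rewrite -(zmod_morphism_linear flin). Qed.

Lemma nonexpansive_dense_cvg (T : Type) (F : set_system T) (f : T -> U -> W)
    (g : U -> W) (D : set U) : Filter F -> dense D ->
    (forall t, nonexpansive (f t)) -> nonexpansive g ->
    (forall x, D x -> f t x @[t --> F] --> g x) ->
  forall x, f t x @[t --> F] --> g x.
Proof.
move=> FF Ddense f_nonexp g_nonexp fg x; apply/cvgrPdist_lt => e e_gt0.
have e3_gt0 : 0 < e / 3 by rewrite divr_gt0.
have [y [/interior_subset xy Dy]] : (ball x (e / 3))° `&` D !=set0.
  apply: Ddense; last exact: open_interior.
  by exists x; exact: nbhsx_ballx.
move: xy; rewrite -ball_normE/= => xy.
near=> t; rewrite [ltRHS](_ : e = e / 3 + (e / 3 + e / 3)); last by field.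
have -> : g x - f t x = (g x - g y) + ((g y - f t y) + (f t y - f t x)).
  by rewrite !addrA !subrK.
rewrite (le_lt_trans (ler_normD _ _))// ltrD ?(le_lt_trans (g_nonexp _ _))//.
rewrite (le_lt_trans (ler_normD _ _))// ltrD//; last first.
  by rewrite (le_lt_trans (f_nonexp _ _ _))// distrC.
by near: t; move/cvgrPdist_lt : (fg _ Dy); exact.
Unshelve. all: by end_near. Qed.

End nonexpansive.

Lemma cvg_sum (K : numFieldType) (V : normedModType K) (I T : Type)
    (F : set_system T) (r : seq I) (f : I -> T -> V) (g : I -> V) : Filter F ->
    (forall i, f i t @[t --> F] --> g i) ->
  \sum_(i <- r) f i t @[t --> F] --> \sum_(i <- r) g i.
Proof. by move=> FF fg; apply: cvg_big => //; exact: add_continuous. Qed.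

Lemma linear_sum_scale (K : pzRingType) (U W : lmodType K) (I : Type)
    (r : seq I) (f : U -> W) (c : I -> K) (v : I -> U) : linear f ->
  f (\sum_(i <- r) c i *: v i) = \sum_(i <- r) c i *: f (v i).
Proof.
move=> flin.
pose g : {linear U -> W} := HB.pack f (GRing.isLinear.Build _ _ _ _ f flin).
by rewrite -[f]/(g : U -> W) linear_sum; apply: eq_bigr => i _; rewrite linearZ.
Qed.

Section inner_product_space.
Context (R : realType) (H : normedModType R[i]) (dot : {dot H for conjC}).
Hypothesis dot_norm : induces_norm dot.
Implicit Types (x y : H) (e : nat -> H).

Lemma norm_dot_le x y : `|dot x y| <= `|x| * `|y|.
Proof.
rewrite -(ler_pXn2r (n := 2)) ?nnegrE ?mulr_ge0// exprMn !dot_norm.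
exact: dot_CauchySchwarz.
Qed.

Lemma ler_norm_dnorm x y : (`|x| <= `|y|) = (dot x x <= dot y y).
Proof. by rewrite -!dot_norm ler_pXn2r ?nnegrE. Qed.

Lemma cvg_dot {T : Type} (F : set_system T) {FF : Filter F} (f g : T -> H) x y :
  f @ F --> x -> g @ F --> y ->
  (fun t => dot (f t) (g t) : R[i]^o) @ F --> (dot x y : R[i]^o).
Proof.
move=> fx gy; apply/cvgrPdist_lt => r r_gt0.
have dist0 (h : T -> H) z :
    h @ F --> z -> (`|z - h t| : R[i]^o) @[t --> F] --> 0.
  move=> hz; apply/norm_cvg0P; rewrite -(subrr z).
  by apply: cvgB => //; exact: cvg_cst.
have bound0 : (`|x - f t| * `|y| + `|f t| * `|y - g t| : R[i]^o) @[t --> F] -->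
    (0 * `|y| + `|x| * 0 : R[i]^o).
  apply: cvgD; apply: cvgM.
  - exact: dist0.
  - exact: cvg_cst.
  - exact: cvg_norm.
  - exact: dist0.
rewrite mul0r mulr0 addr0 in bound0.
near=> t.
have -> : dot x y - dot (f t) (g t) = dot (x - f t) y + dot (f t) (y - g t).
  by rewrite linearBl linearBr/= addrA subrK.
rewrite (le_lt_trans (ler_normD _ _))//.
rewrite (le_lt_trans (lerD (norm_dot_le _ _) (norm_dot_le _ _)))//.
rewrite -[ltLHS]ger0_norm; last by rewrite addr_ge0// mulr_ge0.
by near: t; exact: (cvgr0_norm_lt _ bound0).
Unshelve. all: by end_near. Qed.

Lemma dyad_sum_nonexpansive (I : eqType) (v : I -> H) (r : seq I) :
  orthonormal_family dot v -> uniq r -> nonexpansive (dyad_sum dot v v r).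
Proof.
move=> v_on r_uniq; apply: linear_nonexpansive => [|x].
  exact: adjoint_linear (dyad_sum_adjoint dot v v r).
by rewrite ler_norm_dnorm dnorm_sum_orthonormal// bessel.
Qed.

Lemma adjoint_isometry_le V A x :
  adjoint dot A V -> cancel V A -> `|A x| <= `|x|.
Proof.
move=> AV VK; rewrite ler_norm_dnorm -subr_ge0.
have -> : dot x x - dot (A x) (A x) = dot (x - V (A x)) (x - V (A x)).
  rewrite dnormB [dot (V (A x)) _](adjointC AV) VK -[dot x (V _)]AV -dotC.
  by rewrite opprD addrA addrK.
exact: dnorm_ge0.
Qed.

Definition orthonormal_basis e := orthonormal_family dot e /\
  forall x, dyad_sum dot e e (index_iota 0 n) x @[n --> \oo] --> x.

Lemma orthonormal_basis_exists :
  infinite_dimensional H -> separable_space H -> exists e, orthonormal_basis e.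
Proof.
move=> dimH [D /pcard_surjP[d Dd] Ddense].
have [e [e_on de]] := gram_schmidt dot d dimH.
exists e; split=> //.
apply: (nonexpansive_dense_cvg (g := idfun) _ Ddense) => // [n|x Dx].
  exact: dyad_sum_nonexpansive (iota_uniq _ _).
have [n _ <-] := Dd _ Dx; apply: cvg_near_cst; exists n.+1 => // m /= nm.
exact: dyad_sum_fixed_leq nm (de n).
Qed.

Lemma orthonormal_basis_cvg e (W : normedModType R[i]) (T : Type)
    (F : set_system T) (f : T -> H -> W) (g : H -> W) :
    Filter F -> orthonormal_basis e ->
    (forall t, linear (f t)) -> (forall t, nonexpansive (f t)) ->
    linear g -> nonexpansive g ->
    (forall k, f t (e k) @[t --> F] --> g (e k)) ->
  forall x, f t x @[t --> F] --> g x.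
Proof.
move=> FF [_ e_dense] flin f_nonexp glin g_nonexp fg.
pose partial_sum (p : nat * H) := dyad_sum dot e e (index_iota 0 p.1) p.2.
have partial_sum_dense : dense (range partial_sum).
  move=> O [x Ox] oO.
  have [n _ On] := e_dense x O (open_nbhs_nbhs (conj oO Ox)).
  by exists (partial_sum (n, x)); split; [exact: On (leqnn n)|exists (n, x)].
apply: (nonexpansive_dense_cvg _ partial_sum_dense) => // _ [[n x] _ <-].
rewrite /partial_sum linear_sum_scale//.
rewrite (_ : (fun t => _) =
    (fun t => \sum_(0 <= k < n) dot x (e k) *: f t (e k))); last first.
  by apply/funext => t; exact: linear_sum_scale.
by apply: cvg_sum => k; exact: cvgZl_tmp.
Qed.

End inner_product_space.

Section partial_isometry.
Context (R : realType) (H : completeNormedModType R[i]).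
Context (dot : {dot H for conjC}).
Hypothesis dot_norm : induces_norm dot.
Implicit Types (x y : H) (u v w e : nat -> H).

Lemma riesz_fischer w (c : nat -> R[i]) (M : R[i]) : orthonormal_family dot w ->
    (forall n, \sum_(0 <= k < n) `|c k| ^+ 2 <= M) ->
  cvgn (series (fun k => c k *: w k)).
Proof.
move=> w_on cM; apply/cauchy_cvgP/cauchy_seriesP => r r_gt0.
have ReC (z : R[i]) : 0 <= z -> (complex.Re z)%:C = z.
  by move=> z_ge0; rewrite RRe_real// ger0_real.
pose s k : R := complex.Re (`|c k| ^+ 2).
have sC k : (s k)%:C = `|c k| ^+ 2 by rewrite ReC// exprn_ge0.
have s_ge0 k : 0 <= s k by rewrite -lecR sC exprn_ge0.
have /cauchy_cvgP/cauchy_seriesP s_cauchy : cvgn (series s).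
  apply: nondecreasing_is_cvgn; first by apply: nondecreasing_series => k _ _.
  exists (complex.Re M) => _ [n _ <-]; rewrite -lecR ReC; last first.
    by apply: le_trans (cM 0%N); rewrite big_geq.
  by rewrite rmorph_sum/=; under eq_bigr do rewrite sC.
have r2_gt0 : 0 < complex.Re (r ^+ 2).
  by rewrite -ltcR ReC ?exprn_gt0 ?exprn_ge0 ?ltW.
apply: filterS (s_cauchy _ r2_gt0) => -[m n] /=.
rewrite ger0_norm ?sumr_ge0// -ltcR ReC ?exprn_ge0 ?(ltW r_gt0)// rmorph_sum/=.
under eq_bigr do rewrite sC.
rewrite -(dnorm_sum_orthonormal _ w_on (iota_uniq _ _)) -dot_norm.
by rewrite ltr_pXn2r ?nnegrE ?(ltW r_gt0).
Qed.

Definition partial_isometry v w x : H :=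
  limn (fun n => dyad_sum dot v w (index_iota 0 n) x).

Lemma cvg_partial_isometry v w x :
    orthonormal_family dot v -> orthonormal_family dot w ->
  dyad_sum dot v w (index_iota 0 n) x @[n --> \oo] --> partial_isometry v w x.
Proof.
move=> v_on w_on.
apply: (@riesz_fischer w (fun k => dot x (v k)) (dot x x)) => // n.
exact: bessel (iota_uniq _ _).
Qed.

Lemma partial_isometry_adjoint v w :
    orthonormal_family dot v -> orthonormal_family dot w ->
  adjoint dot (partial_isometry v w) (partial_isometry w v).
Proof.
move=> v_on w_on x y.
apply: (@cvg_unique R[i]^o _
    (dot (dyad_sum dot v w (index_iota 0 n) x) y @[n --> \oo])) => //.
  by apply: cvg_dot => //; [exact: cvg_partial_isometry|exact: cvg_cst].
rewrite (_ : (fun n => dot _ y) =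
    (fun n => dot x (dyad_sum dot w v (index_iota 0 n) y))); last first.
  by apply/funext => n; exact: dyad_sum_adjoint.
by apply: cvg_dot => //; [exact: cvg_cst|exact: cvg_partial_isometry].
Qed.

Lemma dot_partial_isometry v w x k :
    orthonormal_family dot v -> orthonormal_family dot w ->
  dot (partial_isometry v w x) (w k) = dot x (v k).
Proof.
move=> v_on w_on; rewrite partial_isometry_adjoint//; congr (dot x _).
apply: cvg_lim => //; apply: cvg_near_cst; exists k.+1 => // n /= kn.
rewrite /dyad_sum (bigD1_seq k) ?mem_index_iota ?iota_uniq//= w_on eqxx scale1r.
by rewrite big1 ?addr0// => i /negPf ik; rewrite w_on eq_sym ik scale0r.
Qed.

Lemma partial_isometry_comp u v w x : orthonormal_family dot u ->
    orthonormal_family dot v -> orthonormal_family dot w ->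
  partial_isometry v w (partial_isometry u v x) = partial_isometry u w x.
Proof.
move=> u_on v_on w_on; congr (limn _); apply/funext => n; apply: eq_bigr => k _.
by rewrite dot_partial_isometry.
Qed.

Lemma partial_isometry_basis e x :
  orthonormal_basis dot e -> partial_isometry e e x = x.
Proof. by move=> [_ e_dense]; exact: cvg_lim. Qed.

Lemma partial_isometryK e v :
    orthonormal_basis dot e -> orthonormal_family dot v ->
  cancel (partial_isometry e v) (partial_isometry v e).
Proof.
move=> e_basis v_on x; have [e_on _] := e_basis.
by rewrite partial_isometry_comp// partial_isometry_basis.
Qed.

End partial_isometry.

Section corner.
Context (R : realType) (H : normedModType R[i]) (dot : {dot H for conjC}).
Context (V A : H -> H).
Hypothesis AV : adjoint dot A V.
Implicit Types (x y : H) (U : H -> H).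

(* When [V] is an isometry, [V A] is the orthogonal projection onto its range:
   [corner U] is the copy of [U] on that range, extended by the identity. *)
Definition corner U x := V (U (A x)) + (x - V (A x)).

Lemma dot_corner U x y :
  dot (corner U x) y = dot (U (A x)) (A y) + dot x y - dot (A x) (A y).
Proof. by rewrite linearDl/= linearBl/= !(adjointC AV) addrA. Qed.

Lemma corner_cst0 U : A =1 cst 0 -> corner U =1 idfun.
Proof.
move=> A0 x; apply: (dot_inj (dot := dot)) => y.
by rewrite dot_corner !A0 !linear0r subr0 add0r.
Qed.

Lemma corner_linear U : linear U -> linear (corner U).
Proof.
have [Alin Vlin] := (adjoint_linear AV, adjoint_linear (adjointC AV)).
move=> Ulin a x y; rewrite /corner !(Alin, Ulin, Vlin) scalerDr scalerBr.
by rewrite opprD [a *: x + y + _]addrACA [LHS]addrACA.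
Qed.

Hypothesis VK : cancel V A.

Lemma adjoint_corner U x : A (corner U x) = U (A x).
Proof.
by apply: (dot_inj (dot := dot)) => y; rewrite AV dot_corner VK -AV addrK.
Qed.

Lemma corner_comp U U' x : corner U (corner U' x) = corner (U \o U') x.
Proof.
by rewrite {1}/corner adjoint_corner /corner/= addrAC subrr add0r.
Qed.

Lemma corner_id : corner idfun =1 idfun.
Proof. by move=> x; rewrite /corner/= addrC subrK. Qed.

Lemma corner_unitary U : unitary dot U -> unitary dot (corner U).
Proof.
move=> [Ulin [U' UK U'K] Uiso]; split; first exact: corner_linear.
- exists (corner U') => x; rewrite corner_comp.
    by rewrite (_ : U' \o U = idfun) ?corner_id//; exact/funext.
  by rewrite (_ : U \o U' = idfun) ?corner_id//; exact/funext.
- have dotU x y : dot (U x) (U y) = dot x y by exact: Uiso.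
  move=> x y; rewrite -[LHS]/(dot (corner U x) (corner U y)) -[RHS]/(dot x y).
  rewrite dot_corner adjoint_corner dotU [dot x (corner U y)]dotC dot_corner.
  by rewrite rmorphB rmorphD/= -!dotC; ring.
Qed.

End corner.

Section strong_topology.
Context (R : realType) (H : normedModType R[i]) (dot : {dot H for conjC}).
Hypothesis dot_norm : induces_norm dot.
Implicit Types (x y : H) (U : unitary_group dot).

Lemma norm_unitary U x : `|set_val U x| = `|x|.
Proof.
have [_ _ Uiso] := unitary_groupP U.
apply/eqP; rewrite -(eqrXn2 (n := 2))// !dot_norm; apply/eqP; exact: Uiso.
Qed.

Lemma unitary_nonexpansive U : nonexpansive (set_val U).
Proof.
have [Ulin _ _] := unitary_groupP U.
by apply: linear_nonexpansive => // x; rewrite norm_unitary.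
Qed.

Lemma sqr_dist_unitary_le U U' x : `|set_val U x - set_val U' x| ^+ 2 <=
  2 * `|dot (set_val U x) (set_val U x) - dot (set_val U' x) (set_val U x)|.
Proof.
set y := set_val U x; set z := set_val U' x; set d := dot y y - dot z y.
rewrite -[leLHS]ger0_norm ?exprn_ge0//; have -> : `|y - z| ^+ 2 = d + conjC d.
  rewrite dot_norm dnormB rmorphB/= -!dotC -[dot z z]dot_norm norm_unitary.
  by rewrite -(norm_unitary U) dot_norm -/y /d; ring.
by rewrite (le_trans (ler_normD _ _))// norm_conjC mulr2n mulrDl mul1r.
Qed.

Context (T : Type) (F : set_system T) {FF : Filter F}.
Implicit Type f : T -> unitary_group dot.

Lemma weak_strong_cvg f U :
    (forall x y, (dot (set_val (f t) x) y : R[i]^o) @[t --> F] -->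
                 (dot (set_val U x) y : R[i]^o)) ->
  f @ F --> U.
Proof.
move=> fU; apply/strong_normP => x r r_gt0.
have r2_gt0 : 0 < r ^+ 2 / 2 by rewrite divr_gt0// exprn_gt0.
have /cvgrPdist_lt/(_ _ r2_gt0) := fU x (set_val U x).
apply: filterS => t /= dot_lt.
rewrite -(ltr_pXn2r (n := 2)) ?nnegrE ?(ltW r_gt0)//.
by rewrite (le_lt_trans (sqr_dist_unitary_le _ _ _))// mulrC -ltr_pdivlMr.
Qed.

Lemma cvg_unitary_eval f U (g : T -> H) x : f @ F --> U -> g @ F --> x ->
  set_val (f t) (g t) @[t --> F] --> set_val U x.
Proof.
move=> fU gx; apply/cvgrPdist_lt => r r_gt0.
have r2_gt0 : 0 < r / 2 by rewrite divr_gt0.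
have /strong_normP/(_ x _ r2_gt0) fx := fU.
have /cvgrPdist_lt/(_ _ r2_gt0) {}gx := gx.
near=> t; rewrite -(subrK (set_val (f t) x) (set_val U x)) -addrA [ltRHS]splitr.
rewrite (le_lt_trans (ler_normD _ _))// ltrD//; first by near: t; exact: fx.
by rewrite (le_lt_trans (unitary_nonexpansive _ _ _))//; near: t.
Unshelve. all: by end_near. Qed.

End strong_topology.

Section isometry_path.
Context (R : realType) (H : normedModType R[i]) (dot : {dot H for conjC}).
Hypothesis dot_norm : induces_norm dot.
Context (V A : R -> H -> H).
Hypothesis AV : forall t, adjoint dot (A t) (V t).
Hypothesis VK : forall t, t < 1 -> cancel (V t) (A t).
Hypothesis A_ge1 : forall t, 1 <= t -> A t =1 cst 0.
Hypothesis V0 : V 0 =1 idfun.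
Hypothesis A_continuous : forall x, continuous (A ^~ x).

Lemma path_corner_unitary t (U : unitary_group dot) :
  unitary dot (corner (V t) (A t) (set_val U)).
Proof.
have [t1|t1] := ltP t 1.
  exact: (corner_unitary (AV t) (VK t1) (unitary_groupP U)).
rewrite (_ : corner _ _ _ = idfun); first exact: unitary_id.
by apply/funext; exact: (corner_cst0 (AV t) _ (A_ge1 t1)).
Qed.

Definition corner_homotopy (p : R * unitary_group dot) : unitary_group dot :=
  to_unitary (path_corner_unitary p.1 p.2).

Lemma corner_homotopy_continuous : continuous corner_homotopy.
Proof.
move=> [t U]; apply: (weak_strong_cvg dot_norm) => x y.
have Ap z : A p.1 z @[p --> (t, U)] --> A t z.
  apply: (@cvg_comp _ _ _ fst (A ^~ z) _ (nbhs t)); first exact: cvg_fst.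
  exact: A_continuous.
rewrite [X in _ --> X](dot_corner (AV t)).
rewrite (_ : (fun p => _) = (fun p : R * unitary_group dot =>
    dot (set_val p.2 (A p.1 x)) (A p.1 y) + dot x y - dot (A p.1 x) (A p.1 y))).
  apply: cvgB; last exact: cvg_dot.
  apply: cvgD; last exact: cvg_cst.
  apply: cvg_dot => //.
  by apply: (cvg_unitary_eval dot_norm) => //; exact: cvg_snd.
by apply/funext => p; exact: dot_corner.
Qed.

Lemma isometry_path_contractible : contractible R (unitary_group dot).
Proof.
have A0 : A 0 =1 idfun by move=> x; have := VK ltr01 x; rewrite V0.
exists (to_unitary (unitary_id dot)), corner_homotopy; split.
- exact/continuous_subspaceT/corner_homotopy_continuous.
- move=> U; apply: unitary_group_inj => x.
  rewrite -[LHS]/(corner (V 0) (A 0) (set_val U) x) /corner !V0 !A0.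
  by rewrite subrr addr0.
- move=> U; apply: unitary_group_inj => x.
  exact: (corner_cst0 (AV 1) _ (A_ge1 _)).
Qed.

End isometry_path.

Section half_line.
Context (R : realType).

Definition half_line_param (t : R) : R := (1 - t)^-1 - 1.

Lemma half_line_param0 : half_line_param 0 = 0.
Proof. by rewrite /half_line_param subr0 invr1 subrr. Qed.

Lemma half_line_param_continuous (t : R) : t != 1 ->
  {for t, continuous half_line_param}.
Proof.
move=> t1; apply: (@cvgB _ R^o); last exact: cvg_cst.
apply: cvgV; first by rewrite subr_eq0 eq_sym.
by apply: (@cvgB _ R^o); [exact: cvg_cst|exact: cvg_id].
Qed.

Lemma half_line_param_pinfty : half_line_param t @[t --> 1^'-] --> +oo.
Proof.
have to0 : 1 - t @[t --> 1^'-] --> (0 : R).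
  rewrite -[X in _ --> X](subrr (1 : R)).
  by apply: (@cvgB _ R^o); [exact: cvg_cst|exact: cvg_at_left_filter cvg_id].
have pos : \forall t \near 1^'-, 0 < 1 - t :> R by near=> t; rewrite subr_gt0.
apply/cvgryPge => M; near=> t; rewrite lerBrDr; near: t.
exact: (cvgryPge _).1 ((cvgrVy pos).2 to0) _.
Unshelve. all: by end_near. Qed.

Lemma half_line_extension_continuous (X : topologicalType) (f : R -> X)
    (l : X) :
    continuous f -> f u @[u --> +oo] --> l ->
  continuous (fun t : R => if t < 1 then f (half_line_param t) else l).
Proof.
move=> fcont fl t; have [t1|t1|->] := ltgtP t 1.
- rewrite /continuous_at t1.
  apply: (@cvg_trans _ (f (half_line_param s) @[s --> t])).
    by apply: near_eq_cvg; near=> s; rewrite ifT//; near: s; exact: lt_nbhsl.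
  apply: (@continuous_comp _ _ _ half_line_param f); last exact: fcont.
  by apply: half_line_param_continuous; rewrite lt_eqF.
- rewrite /continuous_at lt_gtF//; apply: cvg_near_cst; near=> s.
  by rewrite lt_gtF//; near: s; exact: lt_nbhsr.
- apply/left_right_continuousP; rewrite /= ltxx; split.
    apply: (@cvg_trans _ (f (half_line_param s) @[s --> 1^'-])).
      by apply: near_eq_cvg; near=> s; rewrite ifT.
    exact: (cvg_comp _ _ half_line_param_pinfty fl).
  by apply: cvg_near_cst; near=> s; rewrite lt_gtF.
Unshelve. all: by end_near. Qed.

End half_line.

Lemma half_line_isometry_path_contractible (R : realType)
    (H : normedModType R[i]) (dot : {dot H for conjC}) (V A : R -> H -> H) :
    induces_norm dot ->
    (forall u, adjoint dot (A u) (V u)) -> (forall u, cancel (V u) (A u)) ->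
    V 0 =1 idfun -> (forall x, continuous (A ^~ x)) ->
    (forall x, A u x @[u --> +oo] --> 0) ->
  contractible R (unitary_group dot).
Proof.
move=> dot_norm AV VK V0 A_cont A_pinfty.
pose at_time (B : R -> H -> H) t x :=
  if t < 1 then B (half_line_param t) x else 0.
apply: (isometry_path_contractible dot_norm (V := at_time V) (A := at_time A))
  => [t x y|t t1 x|t t1 x|x|x]; rewrite /at_time.
- by case: ifP => _; [exact: AV|rewrite linear0l linear0r].
- by rewrite t1 VK.
- by rewrite ltNge t1.
- by rewrite ltr01 half_line_param0 V0.
- exact: (half_line_extension_continuous (A_cont x) (A_pinfty x)).
Qed.

Section rotation_coefficients.
Context {R : realType}.
Implicit Types (i j k l m n : nat) (u : R).

(* The fraction, at time [u], of the [j]-th move of the [k]-th vector, from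
   [e (k + j - 1)] to [e (k + j)]; the [j.+1]-st move starts at time
   [j + 1 / (k + 2)] and ends at time [j + 1 / (k + 1)]. *)
Definition move_progress k j u : R := if j is i.+1 then
  Num.max 0 (Num.min 1 (k.+1%:R * (k.+2%:R * (u - i%:R) - 1))) else 1.

Lemma move_progress_ge0 k j u : 0 <= move_progress k j u.
Proof. by case: j => [|j] /=; rewrite ?ler01// le_max lexx. Qed.

Lemma move_progress_le1 k j u : move_progress k j u <= 1.
Proof. by case: j => [|j] //=; rewrite ge_max ler01 ge_min lexx. Qed.

Lemma move_progress_eq0 k j u :
  k.+2%:R * (u - j%:R) <= 1 -> move_progress k j.+1 u = 0.
Proof.
move=> uj; apply/max_idPl; rewrite ge_min; apply/orP; right.
by rewrite pmulr_rle0 ?ltr0n// subr_le0.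
Qed.

Lemma move_progress_eq1 k j u :
  1 <= k.+1%:R * (u - j%:R) -> move_progress k j.+1 u = 1.
Proof.
move=> uj; have le1 : 1 <= k.+1%:R * (k.+2%:R * (u - j%:R) - 1) :> R.
  have : k.+1%:R * 1 <= k.+1%:R * (k.+1%:R * (u - j%:R)) :> R.
    by rewrite ler_wpM2l.
  by rewrite -[k.+2%:R]natr1; lra.
by rewrite /move_progress (min_idPl le1); apply/max_idPr.
Qed.

Lemma move_progress_before k j u : u <= j%:R -> move_progress k j.+1 u = 0.
Proof.
move=> uj; apply: move_progress_eq0; apply: (@le_trans _ _ 0) => //.
by rewrite pmulr_rle0// subr_le0.
Qed.

Lemma move_progress_after k j u : j.+1%:R <= u -> move_progress k j.+1 u = 1.
Proof.
move=> ju; apply: move_progress_eq1; rewrite -[leLHS]mulr1.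
by rewrite ler_pM// ?ler1n// lerBrDl natr1.
Qed.

Definition move_bound u := (Num.truncn u).+2.

Lemma move_progress_ge_bound k j u :
  (move_bound u <= j)%N -> move_progress k j u = 0.
Proof.
case: j => // j; rewrite ltnS => uj; apply: move_progress_before.
by rewrite (le_trans (ltW (truncnS_gt u)))// ler_nat.
Qed.

Lemma move_progress_pred k j u :
  move_progress k j u * move_progress k j.+1 u = move_progress k j.+1 u.
Proof.
case: j => [|j]; first by rewrite mul1r.
have [uj|ju] := leP u j.+1%:R.
  by rewrite (move_progress_before _ uj) mulr0.
by rewrite (move_progress_after _ (ltW ju)) mul1r.
Qed.

(* Larger indices move first: the [k]-th vector starts its [(i + d).+1]-st move
   only once the [l]-th one has completed its [i.+1]-st move. *)
Lemma move_progress_stagger k l i d u : (k < l)%N ->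
  move_progress k (i + d).+1 u * Num.sqrt (1 - move_progress l i.+1 u ^+ 2) = 0.
Proof.
move=> kl; have [uk|ku] := leP (k.+2%:R * (u - (i + d)%:R)) 1.
  by rewrite move_progress_eq0 ?mul0r.
have u_gt : 0 < u - (i + d)%:R.
  by rewrite -(pmulr_rgt0 _ (ltr0Sn R k.+1)) (lt_trans _ ku).
rewrite [move_progress l _ _]move_progress_eq1 ?expr1n ?subrr ?sqrtr0 ?mulr0//.
rewrite (le_trans (ltW ku))// ler_pM// ?(ltW u_gt) ?ler_nat//.
by rewrite lerD2l lerN2 ler_nat leq_addr.
Qed.

Lemma move_progress_continuous k j : continuous (move_progress k j).
Proof.
case: j => [|j] u; first exact: cvg_cst.
pose f x : R^o := k.+1%:R * (k.+2%:R * (x - j%:R) - 1).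
have f_cont : {for u, continuous f}.
  apply: cvgM; first exact: cvg_cst.
  apply: cvgB; last exact: cvg_cst.
  apply: cvgM; first exact: cvg_cst.
  by apply: cvgB; [exact: cvg_id|exact: cvg_cst].
have cst_cont (a : R) : {for u, continuous (cst a : R -> R^o)}.
  exact: cvg_cst.
exact: (continuous_max (cst_cont 0) (continuous_min (cst_cont 1) f_cont)).
Qed.

(* The coordinate of the [k]-th vector along [e m], at time [u]: the progress of
   a move is the sine of the angle of the rotation. *)
Definition rotation_coef k m u : R := if (k <= m)%N then
  move_progress k (m - k) u * Num.sqrt (1 - move_progress k (m - k).+1 u ^+ 2)
  else 0.

Lemma rotation_coef_lt k m u : (m < k)%N -> rotation_coef k m u = 0.
Proof. by rewrite /rotation_coef ltnNge => /negbTE->. Qed.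

Lemma rotation_coef_ge_bound k m u :
  (k + move_bound u <= m)%N -> rotation_coef k m u = 0.
Proof.
move=> km; rewrite /rotation_coef move_progress_ge_bound ?mul0r ?if_same//.
by rewrite leq_subRL// (leq_trans (leq_addr _ _) km).
Qed.

Lemma rotation_coef_after k m u : m.+1%:R <= u -> rotation_coef k m u = 0.
Proof.
move=> mu; rewrite /rotation_coef; case: ifP => // km.
rewrite [move_progress k _.+1 u]move_progress_after.
  by rewrite expr1n subrr sqrtr0 mulr0.
by rewrite (le_trans _ mu)// ler_nat ltnS leq_subr.
Qed.

Lemma rotation_coef0 k m : rotation_coef k m 0 = (k == m)%:R.
Proof.
rewrite /rotation_coef move_progress_before// expr0n subr0 sqrtr1 mulr1.
have [km|mk|->] := ltngtP k m; rewrite ?subnn//.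
move: km; rewrite -subn_gt0; case: (m - k)%N => // d _.
exact: move_progress_before.
Qed.

Lemma rotation_coef_continuous k m : continuous (rotation_coef k m).
Proof.
rewrite /rotation_coef; case: (k <= m)%N => u; last exact: cvg_cst.
apply: cvgM; first exact: move_progress_continuous.
apply: (@continuous_comp _ _ _
  (fun u => 1 - move_progress k (m - k).+1 u ^+ 2) Num.sqrt).
  apply: cvgB; first exact: cvg_cst.
  by apply: cvgM; exact: move_progress_continuous.
exact: sqrt_continuous.
Qed.

Lemma rotation_coef_orthogonal k l m u : (k < l)%N ->
  rotation_coef k m u * rotation_coef l m u = 0.
Proof.
move=> kl; have [ml|lm] := ltnP m l.
  by rewrite (rotation_coef_lt _ ml) mulr0.
rewrite /rotation_coef lm (leq_trans (ltnW kl) lm).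
have -> : (m - k = (m - l + (l - k.+1)).+1)%N by lia.
by rewrite [X in _ * X]mulrC mulrACA move_progress_stagger// mul0r.
Qed.

Lemma sum_rotation_coef_sqr k n u :
  \sum_(0 <= m < k + n) rotation_coef k m u ^+ 2 = 1 - move_progress k n u ^+ 2.
Proof.
elim: n => [|n IH].
  rewrite addn0 expr1n subrr big_nat_cond big1// => m /andP[/= mk _].
  by rewrite rotation_coef_lt// expr0n.
rewrite addnS big_nat_recr//= IH /rotation_coef leq_addr addKn exprMn sqr_sqrtr.
  by rewrite mulrBr mulr1 -exprMn move_progress_pred addrA subrK.
by rewrite subr_ge0 expr_le1 ?move_progress_le1 ?move_progress_ge0.
Qed.

End rotation_coefficients.

Lemma real_complex_continuous (R : realType) :
  continuous (fun a : R => a%:C : R[i]^o).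
Proof.
move=> a; apply/cvgrPdist_lt => r r_gt0.
have rE : (complex.Re r)%:C = r by rewrite RRe_real// gtr0_real.
have Re_gt0 : 0 < complex.Re r by rewrite -ltcR rE.
near=> b; rewrite -rmorphB/= normc_def/= expr0n addr0 sqrtr_sqr -rE ltcR.
by near: b; exact: cvgr_dist_lt Re_gt0.
Unshelve. all: by end_near. Qed.

Section rotated_basis.
Context (R : realType) (H : completeNormedModType R[i]).
Context (dot : {dot H for conjC}).
Hypothesis dot_norm : induces_norm dot.
Context (e : nat -> H).
Hypothesis e_basis : orthonormal_basis dot e.
Implicit Types (u : R) (x : H).

Let e_on : orthonormal_family dot e := e_basis.1.

Definition rotated_basis u k : H :=
  \sum_(0 <= m < k + move_bound u) (rotation_coef k m u)%:C *: e m.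

Lemma dot_rotated_basis u k m :
  dot (rotated_basis u k) (e m) = (rotation_coef k m u)%:C.
Proof.
rewrite (dot_sum_orthonormal (fun m => (rotation_coef k m u)%:C)) ?iota_uniq//.
by rewrite mem_index_iota leq0n/=; case: ltnP => // /rotation_coef_ge_bound->.
Qed.

Lemma rotated_basis_orthonormal u : orthonormal_family dot (rotated_basis u).
Proof.
move=> k l.
have -> : dot (rotated_basis u k) (rotated_basis u l) =
    (\sum_(0 <= m < k + move_bound u)
       rotation_coef k m u * rotation_coef l m u)%:C.
  rewrite linear_sumlz rmorph_sum/=; apply: eq_bigr => m _.
  rewrite dotZl [dot (e m) _]dotC dot_rotated_basis rmorphM/=.
  by rewrite [conjC _]conjc_real.
have [kl|lk|->] := ltngtP k l.
- by rewrite big1// => m _; exact: rotation_coef_orthogonal.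
- by rewrite big1// => m _; rewrite mulrC rotation_coef_orthogonal.
by rewrite sum_rotation_coef_sqr move_progress_ge_bound// expr0n subr0.
Qed.

Lemma rotated_basis0 k : rotated_basis 0 k = e k.
Proof.
rewrite /rotated_basis (bigD1_seq k) ?iota_uniq ?mem_index_iota//=; last first.
  by rewrite -[ltnLHS]addn0 ltn_add2l.
rewrite rotation_coef0 eqxx scale1r big1 ?addr0// => m /negPf mk.
by rewrite rotation_coef0 eq_sym mk scale0r.
Qed.

Definition rotation_isom u : H -> H :=
  partial_isometry dot e (rotated_basis u).

Definition rotation_coisom u : H -> H :=
  partial_isometry dot (rotated_basis u) e.

Lemma rotation_coisom_adjoint u :
  adjoint dot (rotation_coisom u) (rotation_isom u).
Proof. exact: partial_isometry_adjoint (rotated_basis_orthonormal u) e_on. Qed.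

Lemma rotation_isomK u : cancel (rotation_isom u) (rotation_coisom u).
Proof. exact: partial_isometryK e_basis (rotated_basis_orthonormal u). Qed.

Lemma rotation_isom0 : rotation_isom 0 =1 idfun.
Proof.
move=> x; rewrite /rotation_isom (_ : rotated_basis 0 = e).
  exact: partial_isometry_basis.
by apply/funext; exact: rotated_basis0.
Qed.

Lemma rotation_coisom_linear u : linear (rotation_coisom u).
Proof. exact: adjoint_linear (rotation_coisom_adjoint u). Qed.

Lemma rotation_coisom_nonexpansive u : nonexpansive (rotation_coisom u).
Proof.
apply: linear_nonexpansive => [|x]; first exact: rotation_coisom_linear.
exact: adjoint_isometry_le (rotation_coisom_adjoint u) (rotation_isomK u).
Qed.

Lemma rotation_coisom_basis u m : rotation_coisom u (e m) =
  \sum_(0 <= k < m.+1) (rotation_coef k m u)%:C *: e k.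
Proof.
have coef k : dot (e m) (rotated_basis u k) = (rotation_coef k m u)%:C.
  by rewrite dotC dot_rotated_basis [conjC _]conjc_real.
apply: cvg_lim => //; apply: cvg_near_cst; exists m.+1 => // n /= mn.
rewrite /dyad_sum (big_cat_nat (leq0n m.+1) mn)/= [X in _ + X]big_nat.
rewrite [X in _ + X]big1 ?addr0 => [|k /andP[mk _]].
  by apply: eq_bigr => k _; rewrite coef.
by rewrite coef rotation_coef_lt// scale0r.
Qed.

Lemma rotation_coisom_continuous x : continuous (rotation_coisom ^~ x).
Proof.
move=> u; apply: (orthonormal_basis_cvg (f := rotation_coisom)
  (g := rotation_coisom u) _ e_basis) => [t|t|||m].
- exact: rotation_coisom_linear.
- exact: rotation_coisom_nonexpansive.
- exact: rotation_coisom_linear.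
- exact: rotation_coisom_nonexpansive.
rewrite rotation_coisom_basis (funext (rotation_coisom_basis ^~ m)).
apply: cvg_sum => k; apply: cvgZr_tmp.
apply: (@continuous_comp _ _ _ (rotation_coef k m) (fun a => a%:C : R[i]^o)).
  exact: rotation_coef_continuous.
exact: real_complex_continuous.
Qed.

Lemma rotation_coisom_pinfty x : rotation_coisom u x @[u --> +oo] --> 0.
Proof.
apply: (orthonormal_basis_cvg (f := rotation_coisom) (g := cst 0) _ e_basis)
  => [u|u|a y z|y z|m] /=.
- exact: rotation_coisom_linear.
- exact: rotation_coisom_nonexpansive.
- by rewrite scaler0 addr0.
- by rewrite subrr normr0.
apply: cvg_near_cst; near=> u; rewrite rotation_coisom_basis big1// => k _.
by rewrite rotation_coef_after ?scale0r//; near: u; exact: nbhs_pinfty_ge.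
Unshelve. all: by end_near. Qed.

End rotated_basis.

Theorem mainTheorem4 (R : realType) (H : completeNormedModType R[i])
    (dot : {dot H for conjC}) :
  induces_norm dot -> infinite_dimensional H -> separable_space H ->
  contractible R (unitary_group dot).
Proof.
move=> dot_norm dimH sepH.
have [e e_basis] := orthonormal_basis_exists dot_norm dimH sepH.
apply: (half_line_isometry_path_contractible dot_norm (V := rotation_isom dot e)
  (A := rotation_coisom dot e)) => [u|u||x|x].
- exact: rotation_coisom_adjoint.
- exact: rotation_isomK.
- exact: rotation_isom0.
- exact: rotation_coisom_continuous.
- exact: rotation_coisom_pinfty.
Qed.
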